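(* There exist a large set of H-designs LH$(11,g,5,4)$ and a large set of H-designs LH$(12,g,6,5)$ for each integer $g\geq 2$, with possible exceptions when $g\in\{3,5,7,9,11,13\}$.
   Context: An H-design H$(n,g,k,t)$ is a triple $(Q,G,B)$ where $Q$ is a set of $ng$ points, $G$ is a partition of $Q$ into $n$ groups of size $g$, and $B$ is a set of $k$-subsets of $Q$ (blocks) such that each block meets each group in at most one point and any $t$ points from $t$ distinct groups lie in exactly one block. A large set of H-designs LH$(n,g,k,t)$ is a partition of the set of all $k$-subsets of $Q$ meeting each group of $G$ in at most one point into pairwise disjoint block sets, each of which forms (with $Q$ and $G$) an H-design H$(n,g,k,t)$. *)

(* Defs.v *)
From mathcomp Require Import all_boot.
Set Implicit Arguments. Unset Strict Implicit. Unset Printing Implicit Defensive.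

(* Point set Q = 'I_n * 'I_g (n*g points); the groups of G are the
   fibres {i} * 'I_g of the first projection, i.e. n groups of size g. *)
Definition hpoint (n g : nat) := ('I_n * 'I_g)%type.

Definition hgroup (n g : nat) (i : 'I_n) : {set hpoint n g} :=
  [set x | x.1 == i].

Definition htransverse (n g : nat) (S : {set hpoint n g}) : bool :=
  [forall i : 'I_n, #|S :&: hgroup g i| <= 1].

Definition htrans_ksets (n g k : nat) : {set {set hpoint n g}} :=
  [set S | htransverse S & #|S| == k].

Definition is_Hdesign (n g k t : nat) (B : {set {set hpoint n g}}) : Prop :=
  (forall b, b \in B -> htransverse b /\ #|b| = k) /\
  (forall T : {set hpoint n g}, htransverse T -> #|T| = t ->
     #|[set b in B | T \subset b]| = 1).

Definition is_LHdesign (n g k t : nat) (L : {set {set {set hpoint n g}}}) : Prop :=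
  partition L (htrans_ksets n g k) /\ (forall B, B \in L -> is_Hdesign k t B).

Definition LH_exists (n g k t : nat) : Prop :=
  exists L : {set {set {set hpoint n g}}}, is_LHdesign k t L.

(* Main.v *)
Require Import Defs.
From mathcomp Require Import all_boot.

(** It suffices to find, for n = 11 and n = 12, a multiset of 7g Steiner systems
    S(n-7, n-6, n) covering each (n-6)-subset of the n groups exactly g times.
    Indeed, colour a transverse set with projection K and second coordinates
    summing to s by the (s mod g)-th of the g systems containing K: extending a
    transverse t-set by a point realises each system c exactly once, since c
    determines the new group and then the sum determines the new coordinate.
    Such multisets can be added, so g = 2 and g = 3 generate all g >= 2.  In both
    cases explicit multisets of images of the Witt system S(5,6,12) do the job:
    for g = 2 one system, its negative (twice) and the 11 translates of a twisted
    copy; for g = 3 an orbit of the Frobenius group 7:3 acting on 7 of the 12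
    points.  Deriving at the point 11, fixed by all the permutations used, gives
    the case n = 11. *)

Set Implicit Arguments. Unset Strict Implicit. Unset Printing Implicit Defensive.

(* The finite type C indexes the multiset of systems: chi c is the block set of
   the system c, stated through its unique extension property. *)
Definition uniform_cover (n t g : nat) : Prop :=
  exists (C : finType) (chi : C -> pred {set 'I_n}),
    (forall c (T : {set 'I_n}), #|T| = t ->
       exists x, forall y, (y \notin T) && chi c (y |: T) = (y == x)) /\
    (forall K : {set 'I_n}, #|K| = t.+1 -> #|[pred c | chi c K]| = g).

Lemma uniform_coverD n t g1 g2 :
  uniform_cover n t g1 -> uniform_cover n t g2 -> uniform_cover n t (g1 + g2).
Proof.
move=> [C1 [chi1 [ext1 cov1]]] [C2 [chi2 [ext2 cov2]]].
exists (C1 + C2)%type.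
exists (fun c K => match c with inl c1 => chi1 c1 K | inr c2 => chi2 c2 K end).
split=> [[c|c] T cT | K cK]; [exact: ext1|exact: ext2|].
rewrite -(cov1 K cK) -(cov2 K cK) -!sum1_card big_sumType /=.
by [].
Qed.

(** * From a uniform cover to a large set *)

Section LargeSet.

Variables (n t g : nat) (C : finType) (chi : C -> pred {set 'I_n}).
Hypothesis g_gt0 : 0 < g.
Hypothesis chi_ext : forall c (T : {set 'I_n}), #|T| = t ->
  exists x, forall y, (y \notin T) && chi c (y |: T) = (y == x).
Hypothesis chi_cov :
  forall K : {set 'I_n}, #|K| = t.+1 -> #|[pred c | chi c K]| = g.

Implicit Types (S T : {set hpoint n g}) (p : hpoint n g).

Let proj S : {set 'I_n} := [set p.1 | p in S].
Let hsum S : nat := \sum_(p in S) p.2.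
Let systems S : seq C := enum [pred c | chi c (proj S)].
(** The default [None] is never reached on a transverse set of size [t.+1]: exactly [g] systems
    contain its projection. *)
Let colour S : option C := nth None (map Some (systems S)) (hsum S %% g).

Lemma htransverseP S : reflect {in S &, injective fst} (htransverse S).
Proof.
apply: (iffP forallP) => [tr p q pS qS eq_pq | inj_S i].
  have /card_le1_eqP := tr p.1; apply; rewrite !inE ?pS ?qS ?eq_pq eqxx //.
apply/card_le1_eqP=> p q; rewrite !inE => /andP[pS /eqP p1] /andP[qS /eqP q1].
by apply: inj_S; rewrite // p1 q1.
Qed.

Lemma card_proj S : htransverse S -> #|proj S| = #|S|.
Proof. by move/htransverseP/card_in_imset. Qed.

(** [systems S] has [g] entries without repetition, so a residue mod [g] and a system containing
    [proj S] determine each other. *)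
Lemma colourE S c : htransverse S -> #|S| = t.+1 ->
  (colour S == Some c) =
  chi c (proj S) && (hsum S %% g == index c (systems S)).
Proof.
move=> trS cS; have sz : size (systems S) = g.
  by rewrite -cardE chi_cov // card_proj.
have lt_s : hsum S %% g < size (systems S) by rewrite sz ltn_mod.
rewrite /colour (nth_map c) // (inj_eq Some_inj).
have c_sys : (c \in systems S) = chi c (proj S) by rewrite mem_enum.
apply/eqP/andP=> [<- | [chi_c /eqP->]].
  split; first by rewrite -[chi _ _]/(_ \in [pred c | chi c (proj S)]) -mem_enum mem_nth.
  by rewrite index_uniq ?enum_uniq.
by rewrite nth_index // c_sys.
Qed.

Lemma shift_mod_bij m r : r < g -> exists a : 'I_g, forall b : 'I_g,
  ((b + m) %% g == r) = (b == a).
Proof.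
move=> lt_r; pose f (b : 'I_g) := Ordinal (ltn_pmod (b + m) g_gt0).
have inj_f : injective f.
  move=> a b /(congr1 val) /= /eqP; rewrite eqn_modDr !modn_small // => /eqP.
  exact: val_inj.
have [h hK fK] := injF_bij inj_f.
exists (h (Ordinal lt_r)) => b; rewrite -(inj_eq inj_f) fK.
by [].
Qed.

Lemma colour_class_Hdesign c (B : {set {set hpoint n g}}) :
  B = [set S in htrans_ksets n g t.+1 | colour S == Some c] ->
  is_Hdesign t.+1 t B.
Proof.
move=> ->; split=> [b | T trT cT].
  by rewrite !inE => /andP[/andP[? /eqP]].
have injT := htransverseP _ trT.
have [x xP] := @chi_ext c (proj T) (etrans (card_proj trT) cT).
have /andP[xT chi_x] : (x \notin proj T) && chi c (x |: proj T) by rewrite xP.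
have idx_lt : index c (enum [pred d | chi d (x |: proj T)]) < g.
  have cK : #|x |: proj T| = t.+1 by rewrite cardsU1 xT card_proj // cT.
  by rewrite -[ltnRHS](chi_cov cK) cardE index_mem mem_enum.
have [a aP] := shift_mod_bij (hsum T) idx_lt.
have proj_add p : proj (p |: T) = p.1 |: proj T by rewrite /proj imsetU1.
have hsum_add p : p \notin T -> hsum (p |: T) = p.2 + hsum T.
  by move=> pT; rewrite /hsum big_setU1.
have notinT p : p.1 \notin proj T -> p \notin T.
  by apply: contra => pT; apply: imset_f.
have cardT p : p \notin T -> #|p |: T| = t.+1 by move=> pT; rewrite cardsU1 pT cT.
have tr_add p : p.1 \notin proj T -> htransverse (p |: T).
  move=> pT; apply/htransverseP=> q r /setU1P[->|qT] /setU1P[->|rT] //= eq1.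
  - by case/negP: pT; rewrite eq1 imset_f.
  - by case/negP: pT; rewrite -eq1 imset_f.
  - exact: injT.
suff -> : [set b in [set S in htrans_ksets n g t.+1 | colour S == Some c]
          | T \subset b] = [set (x, a) |: T] by rewrite cards1.
(* A block [S] through [T] adds a single point [p]: unique extension in system [c] forces [p.1 = x],
   and then the sum mod [g] forces [p.2 = a]. *)
apply/setP=> S; rewrite !inE; apply/andP/eqP => [[/andP[/andP[trS /eqP cS] colS] TS] | ->].
  have /eqP/cards1P[p eqp] : #|S :\: T| = 1.
    by rewrite cardsD (setIidPr TS) cS cT subSnn.
  have /setDP[pS pT] : p \in S :\: T by rewrite eqp set11.
  have eqS : S = p |: T by rewrite -(setID S T) (setIidPr TS) eqp setUC.
  have p1T : p.1 \notin proj T.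
    apply/imsetP=> -[q qT eq1]; case/negP: pT.
    by rewrite (htransverseP _ trS _ _ pS (subsetP TS _ qT) eq1).
  move: colS; rewrite colourE // /systems eqS proj_add hsum_add // => /andP[chip].
  have /eqP eqx : p.1 == x by rewrite -xP p1T.
  by rewrite eqx aP => /eqP eqa; rewrite -eqx -eqa -surjective_pairing.
split; last exact: subsetUr.
rewrite tr_add // cardT ?notinT // eqxx /= colourE ?tr_add ?cardT ?notinT // /systems proj_add /= chi_x.
by rewrite hsum_add ?notinT //= aP eqxx.
Qed.

Lemma LH_of_chi : LH_exists n g t.+1 t.
Proof.
exists (preim_partition colour (htrans_ksets n g t.+1)).
split=> [|B]; first exact: preim_partitionP.
case/imsetP=> S SD ->.
have := SD; rewrite inE => /andP[trS /eqP cS].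
have sz : hsum S %% g < size (systems S).
  by rewrite -cardE chi_cov ?ltn_mod // card_proj.
case col: (colour S) => [c|]; last first.
  have : None \in map Some (systems S).
    by rewrite -col /colour mem_nth // size_map.
  by case/mapP.
apply: (@colour_class_Hdesign c); apply/setP=> S'.
by rewrite [LHS]inE [RHS]inE eq_sym.
Qed.

End LargeSet.

Lemma LH_of_uniform_cover n t g :
  0 < g -> uniform_cover n t g -> LH_exists n g t.+1 t.
Proof. by move=> g_gt0 [C [chi [ext cov]]]; apply: LH_of_chi ext cov. Qed.

(** * Checking uniform covers by computation on bit strings *)

Fixpoint words (n k : nat) : seq bitseq :=
  match n with
  | 0 => if k is 0 then [:: [::]] else [::]
  | n'.+1 => map (cons false) (words n' k) ++
             (if k is k'.+1 then map (cons true) (words n' k') else [::])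
  end.

Lemma mem_words (b : bitseq) : b \in words (size b) (count id b).
Proof.
by elim: b => [|[] b IHb] //=; rewrite mem_cat map_f ?orbT.
Qed.

Definition is_unique_extension (f : pred bitseq) (n : nat) (b : bitseq) : bool :=
  count (fun i => ~~ nth false b i && f (set_nth false b i true)) (iota 0 n) == 1.

Definition check_cover (n t g : nat) (D : Type) (sys : D -> pred bitseq)
    (ds : seq D) : bool :=
  all (fun d => all (is_unique_extension (sys d) n) (words n t)) ds &&
  all (fun b => count (fun d => sys d b) ds == g) (words n t.+1).

Lemma count_enum (T : finType) (P : pred T) : count P (enum T) = #|P|.
Proof. by rewrite cardE -size_filter [enum T]enumT. Qed.

Section Bits.

Variable n : nat.
Implicit Types K T : {set 'I_n}.

Definition bits K : bitseq := [seq i \in K | i <- enum 'I_n].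

Lemma size_bits K : size (bits K) = n.
Proof. by rewrite size_map size_enum_ord. Qed.

Lemma count_bits K : count id (bits K) = #|K|.
Proof. by rewrite count_map count_enum. Qed.

Lemma nth_bits K (i : 'I_n) : nth false (bits K) i = (i \in K).
Proof. by rewrite (nth_map i) ?size_enum_ord // nth_ord_enum. Qed.

Lemma bits_words K : bits K \in words n #|K|.
Proof. by rewrite -(count_bits K) -{1}(size_bits K) mem_words. Qed.

Lemma bits_setU1 K (x : 'I_n) : bits (x |: K) = set_nth false (bits K) x true.
Proof.
apply: (@eq_from_nth _ false) => [|i].
  by rewrite size_set_nth !size_bits; apply/esym/maxn_idPr.
rewrite size_bits => lt_i; rewrite nth_set_nth /=.
by rewrite -[i]/(val (Ordinal lt_i)) !nth_bits in_setU1 -val_eqE /=; case: eqP.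
Qed.

(** Systems are indexed by positions in [ds], so that a repeated entry counts with its
    multiplicity. *)
Lemma uniform_cover_of_check t g (D : eqType) (sys : D -> pred bitseq)
    (ds : seq D) :
  check_cover n t g sys ds -> uniform_cover n t g.
Proof.
case/andP=> /allP ext /allP cov.
exists 'I_(size ds), (fun c K => sys (tnth (in_tuple ds) c) (bits K)).
split=> [c T cT|K cK].
  set d := tnth _ c; have /ext/allP/(_ (bits T)) : d \in ds by exact: mem_tnth.
  rewrite -{1}cT bits_words => /(_ isT).
  rewrite /is_unique_extension -val_enum_ord count_map.
  rewrite (@eq_count _ _ [in [set y | (y \notin T) && sys d (bits (y |: T))]]).
    rewrite count_enum => /cards1P[x eqx].
    by exists x => y; move/setP/(_ y): eqx; rewrite !inE.
  by move=> y; rewrite !inE /= nth_bits bits_setU1.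
have := cov (bits K); rewrite -cK bits_words => /(_ isT)/eqP <-.
rewrite -count_enum.
by rewrite -(count_map (tnth (in_tuple ds)) (sys^~ (bits K))) map_tnth_enum.
Qed.

End Bits.

(** * Images of the Witt systems *)

(* The blocks through infinity of the Witt system on the projective line over
   F_11, i.e. an S(4,5,11) invariant under x |-> q x + i for nonzero squares q. *)
Definition s4_base : seq (seq nat) :=
  [:: 1; 3; 4; 5; 9] ::
  [seq [seq (q * x) %% 11 | x <- [:: 0; 1; 2; 3; 5]] | q <- [:: 1; 3; 4; 5; 9]].

Definition s4_blocks : seq bitseq :=
  [seq [seq (x + i) %% 11 \in A | x <- iota 0 11] | A <- s4_base, i <- iota 0 11].

(* A trie instead of a list lookup makes the checks below fifteen times faster. *)
Inductive trie := Leaf of bool | Node of trie & trie.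

Fixpoint trie_of (n : nat) (s : seq bitseq) : trie :=
  if n is n'.+1 then
    if s is [::] then Leaf false else
    Node (trie_of n' [seq behead w | w <- s & ~~ head false w])
         (trie_of n' [seq behead w | w <- s & head false w])
  else Leaf (~~ nilp s).

Fixpoint trie_mem (t : trie) (b : bitseq) : bool :=
  match t, b with
  | Leaf a, _ => a
  | Node t0 t1, x :: b' => trie_mem (if x then t1 else t0) b'
  | Node _ _, [::] => false
  end.

Definition s4_trie : trie := trie_of 11 s4_blocks.

(* sigma lists the values of a permutation of 0..10, and a set belongs to
   system4 sigma when its preimage under sigma is a block. *)
Definition system4 (sigma : seq nat) : pred bitseq :=
  fun b => trie_mem s4_trie [seq nth false b x | x <- sigma].

(* Infinity is the point 11; the blocks avoiding it are the complements of the
   blocks containing it. *)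
Definition system5 (sigma : seq nat) : pred bitseq :=
  fun b => let b' := take 11 b in
           system4 sigma (if nth false b 11 then b' else map negb b').

Definition neg11 (x : nat) : nat := (11 - x) %% 11.

(** The listed values are the nonzero squares mod 11. As 4 is a square, multiplication by 4 permutes
    the nonsquares, so this is a permutation. *)
Definition twist11 (i x : nat) : nat :=
  ((if x \in [:: 1; 3; 4; 5; 9] then x else 4 * x) + i) %% 11.

(** The transposition of 5 and 6, followed by an affine map of the integers mod 7. *)
Definition twist7 (a i x : nat) : nat :=
  if x < 7 then (a * (if x == 5 then 6 else if x == 6 then 5 else x) + i) %% 7
  else x.

(** A system contains one seventh of the sets to cover (66 of 462, or 132 of 924), so a double cover
    takes 14 systems and a triple one 21. *)
Definition family2 : seq (seq nat) :=
  [seq [seq f x | x <- iota 0 11]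
    | f <- [:: id; neg11; neg11] ++ [seq twist11 i | i <- iota 0 11]].

Definition family3 : seq (seq nat) :=
  [seq [seq twist7 a i x | x <- iota 0 11] | a <- [:: 1; 2; 4], i <- iota 0 7].

Lemma s4_family_check_2 : check_cover 11 4 2 system4 family2.
Proof. by vm_compute. Qed.

Lemma s4_family_check_3 : check_cover 11 4 3 system4 family3.
Proof. by vm_compute. Qed.

Lemma s5_family_check_2 : check_cover 12 5 2 system5 family2.
Proof. by vm_compute. Qed.

Lemma s5_family_check_3 : check_cover 12 5 3 system5 family3.
Proof. by vm_compute. Qed.

Lemma uniform_cover_ge2 n t g :
  uniform_cover n t 2 -> uniform_cover n t 3 -> 2 <= g -> uniform_cover n t g.
Proof.
move=> cov2 cov3; elim/ltn_ind: g => -[|[|[|[|g]]]] // IHg _.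
by rewrite -add2n; apply: uniform_coverD => //; apply: IHg.
Qed.

Theorem theorem24 (g : nat) :
  2 <= g -> g \notin [:: 3; 5; 7; 9; 11; 13] ->
  LH_exists 11 g 5 4 /\ LH_exists 12 g 6 5.
Proof.
move=> g_ge2 _; have g_gt0 : 0 < g by apply: leq_trans g_ge2.
split; apply: LH_of_uniform_cover => //; apply: uniform_cover_ge2 => //;
  apply: uniform_cover_of_check.
- exact: s4_family_check_2.
- exact: s4_family_check_3.
- exact: s5_family_check_2.
- exact: s5_family_check_3.
Qed.
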